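(* Let $(b_n)_{n\ge 0}$ be the real sequence defined by $b_0=1$ and $$b_n=\frac{1}{n}\left(-\sum_{k=0}^{n-2}\frac{b_{n-1-k}}{k+2}+\frac{1}{n+1}\right),\qquad n\ge 1,$$ where the sum is empty for $n=1$ (so $b_1=\tfrac12$). If $(d_s)_{s\ge 0}$ is a real sequence such that $$\left(1+\frac{1}{m}\right)^{m}=e\left(d_0-\sum_{s=1}^{\infty}\frac{d_s}{\left(m+\frac{11}{12}\right)^{s}}\right)\qquad\text{for all } m=1,2,3,\ldots,$$ then $d_0=1$ and $$d_s=\Gamma(s)\sum_{k=1}^{s}(-1)^{s-k}\frac{b_k}{\Gamma(s-k+1)\,\Gamma(k)\,12^{s-k}},\qquad s=1,2,3,\ldots.$$
   Context: $\Gamma$ denotes the Euler Gamma function and $e$ is the base of the natural logarithm. *)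

(* Defs.v *)
From Stdlib Require Export Reals List.
From Coquelicot Require Export Coquelicot.
Open Scope R_scope.

(* Euler's integral, improper at both ends; the defining formula of the Gamma
   function for 0 < x.  For x <= 0 the integral diverges and the value is
   unspecified. *)
Definition Gamma (x : R) : R :=
  RInt_gen (fun t : R => Rpower t (x - 1) * exp (- t))
           (at_right 0) (Rbar_locally p_infty).

(* Main.v *)
(* With [y = 1/(m+1)] one has [(1+1/m)^m = exp (P y)], where
   [P y = -(1-y) ln(1-y) / y] is analytic at 0, and the recursion for [b] says that
   [A y = 1 - sum_k b_k y^k] solves [A' = A P'], whence [exp (P y) = e A y].
   Putting [w = 1/(m+11/12)] gives [y = w/(1+w/12)], and the binomial series expands
   each [y^k] in powers of [w].  For every [N] the given series in [w] therefore agrees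
   with the rearranged sum over [k <= N] up to [O(w^(N+1))] along a sequence [w -> 0],
   which determines its coefficients up to order [N]. *)
Require Import Defs.
From Stdlib Require Import Reals List Lra Lia Arith.
From Coquelicot Require Import Coquelicot.
Open Scope R_scope.

(** * The Gamma function at positive integers *)

(** The single Taylor term [t ^ (n+1) / (n+1)!] bounds [exp t] from below, so the product is at most
    [(n+1)! / t] for [t > 0]. *)
Lemma is_lim_pow_mult_exp_opp (n : nat) :
  filterlim (fun t => t ^ n * exp (- t)) (Rbar_locally p_infty) (locally 0).
Proof.
  change (is_lim (fun t => t ^ n * exp (- t)) p_infty 0).
  apply (is_lim_le_le_loc (fun _ => 0) (fun t => INR (fact (S n)) * / t)).
  - exists 0; intros t Ht; split.
    + apply Rmult_le_pos; [apply pow_le; lra | left; apply exp_pos].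
    + assert (Hf := INR_fact_lt_0 (S n)).
      assert (Hp : 0 < t ^ S n) by (apply pow_lt; lra).
      assert (He : t ^ S n / INR (fact (S n)) <= exp t).
      { apply Rle_trans with (2 := exp_ge_taylor t (S n) (Rlt_le _ _ Ht)).
        rewrite tech5.
        assert (0 <= sum_f_R0 (fun k => t ^ k / INR (fact k)) n); [|lra].
        apply cond_pos_sum; intros k; apply Rmult_le_pos; [apply pow_le; lra|].
        left; apply Rinv_0_lt_compat, INR_fact_lt_0. }
      apply Rmult_le_reg_r with (t * exp t);
        [apply Rmult_lt_0_compat; [lra | apply exp_pos]|].
      rewrite exp_Ropp.
      replace (t ^ n * / exp t * (t * exp t)) with (t ^ S n)
        by (simpl; field; apply Rgt_not_eq, exp_pos).
      replace (INR (fact (S n)) * / t * (t * exp t))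
        with (INR (fact (S n)) * exp t) by (field; lra).
      apply Rmult_le_reg_r with (/ INR (fact (S n))); [now apply Rinv_0_lt_compat|].
      replace (INR (fact (S n)) * exp t * / INR (fact (S n))) with (exp t)
        by (field; lra).
      exact He.
  - apply is_lim_const.
  - replace (Finite 0) with (Rbar_mult (INR (fact (S n))) (Rbar_inv p_infty))
      by (simpl; f_equal; ring).
    apply is_lim_scal_l, is_lim_inv; [apply is_lim_id | discriminate].
Qed.

(** Repeated integration by parts of [t ^ n * exp (- t)], with the constant chosen so that the
    primitive vanishes at infinity. *)
Fixpoint gamma_primitive (n : nat) (t : R) : R :=
  match n with
  | O => - exp (- t)
  | S n' => - (t ^ n * exp (- t)) + INR n * gamma_primitive n' t
  end.

Lemma is_derive_gamma_primitive (n : nat) (t : R) :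
  is_derive (gamma_primitive n) t (t ^ n * exp (- t)).
Proof.
  induction n as [|n IH].
  - simpl; auto_derive; [easy | ring].
  - assert (H : is_derive (fun t => - (t ^ S n * exp (- t))) t
      (- (INR (S n) * t ^ n * exp (- t)) + t ^ S n * exp (- t))).
    { auto_derive; [easy|].
      change (match n with O => 1 | S _ => INR n + 1 end) with (INR (S n)).
      simpl pow; ring. }
    evar_last.
    + eapply (is_derive_plus (V := R_NormedModule)); [exact H|].
      apply is_derive_scal; exact IH.
    + change (plus ?x ?y) with (Rplus x y); ring.
Qed.

Lemma gamma_primitive_0 (n : nat) : gamma_primitive n 0 = - INR (fact n).
Proof.
  induction n as [|n IH].
  - simpl; rewrite Ropp_0, exp_0; ring.
  - change (gamma_primitive (S n) 0)
      with (- (0 ^ S n * exp (- 0)) + INR (S n) * gamma_primitive n 0).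
    rewrite IH, fact_simpl, mult_INR, pow_i by lia; ring.
Qed.

Lemma is_lim_gamma_primitive (n : nat) :
  is_lim (gamma_primitive n) p_infty 0.
Proof.
  induction n as [|n IH].
  - apply is_lim_ext with (fun t => - (t ^ 0 * exp (- t))); [intros t; simpl; ring|].
    rewrite <- Ropp_0; apply is_lim_opp with (l := Finite 0), is_lim_pow_mult_exp_opp.
  - replace 0 with (- 0 + INR (S n) * 0) by ring.
    apply is_lim_plus'.
    + apply is_lim_opp with (l := Finite 0), is_lim_pow_mult_exp_opp.
    + now apply is_lim_scal_l with (l := Finite 0).
Qed.

Lemma Gamma_fact (n : nat) : Gamma (INR n + 1) = INR (fact n).
Proof.
  unfold Gamma; apply is_RInt_gen_unique.
  apply is_RInt_gen_ext with (Derive (gamma_primitive n)).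
  (* Both endpoints may be taken positive, and for [t > 0] the real power [Rpower t n] is the
     ordinary power [t ^ n]. The replacement integrand is smooth at 0 as well. *)
  - exists (fun a => 0 < a) (fun b => 0 < b).
    + exists (mkposreal 1 Rlt_0_1); intros y _ Hy; exact Hy.
    + exists 0; easy.
    + intros a b Ha Hb t [Ht _]; simpl in Ht.
      assert (0 < t) by (apply Rlt_trans with (2 := Ht), Rmin_pos; assumption).
      rewrite (is_derive_unique _ _ _ (is_derive_gamma_primitive n t)).
      replace (INR n + 1 - 1) with (INR n) by ring.
      now rewrite Rpower_pow.
  - replace (INR (fact n)) with (0 - gamma_primitive n 0)
      by (rewrite gamma_primitive_0; ring).
    apply is_RInt_gen_Derive.
    + exists (fun _ => True) (fun _ => True); try apply filter_true.
      intros a b _ _ t _; eexists; apply is_derive_gamma_primitive.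
    + exists (fun _ => True) (fun _ => True); try apply filter_true.
      intros a b _ _ t _.
      apply continuous_ext with (fun t => t ^ n * exp (- t)).
      { intros x; symmetry; apply is_derive_unique, is_derive_gamma_primitive. }
      apply (ex_derive_continuous (V := R_NormedModule)); auto_derive; easy.
    + assert (Hc : continuous (gamma_primitive n) 0).
      { apply (ex_derive_continuous (V := R_NormedModule)); eexists.
        apply is_derive_gamma_primitive. }
      intros P HP; specialize (Hc P HP); destruct Hc as [eps He].
      exists eps; intros y Hy _; now apply He.
    + apply is_lim_gamma_primitive.
Qed.

(** * Convergence of power series and vanishing of their coefficients *)

Lemma CV_radius_ge_1_of_bounded (a : nat -> R) (M : R) :
  (forall n, Rabs (a n) <= M) -> Rbar_le 1 (CV_radius a).
Proof.
  intros H; apply (proj1 (CV_radius_bounded a)).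
  exists M; intros n; rewrite pow1, Rmult_1_r; apply H.
Qed.

Lemma lt_CV_radius_of_bounded (a : nat -> R) (M x : R) :
  (forall n, Rabs (a n) <= M) -> Rabs x < 1 -> Rbar_lt (Rabs x) (CV_radius a).
Proof.
  intros H Hx; apply Rbar_lt_le_trans with 1; [exact Hx|].
  now apply CV_radius_ge_1_of_bounded with M.
Qed.

Lemma ex_pseries_of_bounded (a : nat -> R) (M x : R) :
  (forall n, Rabs (a n) <= M) -> Rabs x < 1 -> ex_pseries a x.
Proof. intros H Hx; apply CV_radius_inside; now apply lt_CV_radius_of_bounded with M. Qed.

(** Outside the disk of convergence the terms do not tend to 0. This serves the series built from
    [d], about which only convergence at certain points is given. *)
Lemma CV_radius_pos_of_ex_pseries (a : nat -> R) (x : R) :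
  x <> 0 -> ex_pseries a x -> Rbar_lt 0 (CV_radius a).
Proof.
  intros Hx Ha.
  apply Rbar_lt_le_trans with (Rabs x); [simpl; now apply Rabs_pos_lt|].
  apply Rbar_not_lt_le; intros H.
  apply (CV_disk_outside a x H), ex_series_lim_0; now apply ex_pseries_R.
Qed.

(** Along [w] the left side tends to [u 0] by continuity, and the right side tends to 0 because the
    exponent is at least 1. *)
Lemma PSeries_coeff_0_eq_0 (u w : nat -> R) (g : R -> R) (N : nat) :
  Rbar_lt 0 (CV_radius u) -> is_lim_seq w 0 -> continuity_pt g 0 ->
  (forall m, PSeries u (w m) = w m ^ S N * g (w m)) -> u 0%nat = 0.
Proof.
  intros Hu Hw Hg H.
  assert (L1 : is_lim_seq (fun m => PSeries u (w m)) (u 0%nat)).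
  { rewrite <- (PSeries_0 u); apply is_lim_seq_continuous; [|exact Hw].
    apply PSeries_continuity; now rewrite Rabs_R0. }
  assert (L2 : is_lim_seq (fun m => PSeries u (w m)) 0).
  { replace (Finite 0) with (Finite (0 ^ S N * g 0)) by (simpl; f_equal; ring).
    apply is_lim_seq_ext with (fun m => w m ^ S N * g (w m)); [easy|].
    apply (is_lim_seq_continuous (fun x => x ^ S N * g x)); [|exact Hw].
    apply continuity_pt_mult; [|exact Hg].
    apply derivable_continuous_pt, derivable_pt_pow. }
  apply is_lim_seq_unique in L1; apply is_lim_seq_unique in L2.
  rewrite L1 in L2; now injection L2.
Qed.

(** Once the constant coefficient is known to vanish, dividing by [w m] shifts the series and lowers
    the exponent by one, which is the induction step on [N]. *)
Lemma PSeries_coeff_eq_0 (u w : nat -> R) (g : R -> R) (N : nat) :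
  Rbar_lt 0 (CV_radius u) -> is_lim_seq w 0 -> (forall m, w m <> 0) ->
  continuity_pt g 0 ->
  (forall m, PSeries u (w m) = w m ^ S N * g (w m)) ->
  forall s, (s <= N)%nat -> u s = 0.
Proof.
  intros Hu Hw Hw0 Hg; revert u Hu; induction N as [|N IH]; intros u Hu H;
    assert (Hu0 := PSeries_coeff_0_eq_0 u w g _ Hu Hw Hg H).
  - intros s Hs; now replace s with 0%nat by lia.
  - intros [|s] Hs; [exact Hu0|].
    apply (IH (PS_decr_1 u)); [now rewrite CV_radius_decr_1 | | lia].
    intros m; apply Rmult_eq_reg_l with (w m); [|apply Hw0].
    rewrite <- PSeries_decr_1_aux, H by exact Hu0; simpl; ring.
Qed.

(** * The series of the logarithm and of the exponent [P] *)

(* Junk value: [log_coeff 0 = / 0 = 0]. *)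
Definition log_coeff (n : nat) : R := / INR n.

Lemma log_coeff_bounded (n : nat) : Rabs (log_coeff n) <= 1.
Proof.
  unfold log_coeff; destruct n as [|n]; [simpl; rewrite Rinv_0, Rabs_R0; lra|].
  assert (H := pos_INR n); rewrite S_INR, Rabs_pos_eq.
  - rewrite <- Rinv_1; apply Rinv_le_contravar; lra.
  - left; apply Rinv_0_lt_compat; lra.
Qed.

Lemma PSeries_log_coeff (y : R) : 0 < y < 1 -> PSeries log_coeff y = - ln (1 - y).
Proof.
  intros Hy.
  (* The derivative of the series is the geometric series [1 / (1 - t)], which cancels that of
     [ln (1 - t)]; hence the sum is constant on [[0, y]]. *)
  assert (H : PSeries log_coeff 0 + ln (1 - 0) = PSeries log_coeff y + ln (1 - y)).
  { apply (eq_is_derive (V := R_NormedModule) (fun t => PSeries log_coeff t + ln (1 - t)));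
      [|lra].
    intros t Ht.
    assert (Ht1 : Rabs t < 1) by (rewrite Rabs_pos_eq; lra).
    replace (@zero R_NormedModule) with
      (@plus R_NormedModule (PSeries (PS_derive log_coeff) t) (- / (1 - t))).
    - apply (is_derive_plus (V := R_NormedModule)).
      + apply is_derive_PSeries, lt_CV_radius_of_bounded with 1;
          [apply log_coeff_bounded | exact Ht1].
      + auto_derive; [lra | field; lra].
    - rewrite (PSeries_ext _ (fun _ => 1)).
      + unfold PSeries; rewrite (Series_ext _ (fun k => t ^ k)) by (intros; ring).
        rewrite Series_geom by exact Ht1.
        unfold plus, zero; simpl; ring.
      + intros n; unfold PS_derive, log_coeff; field; apply not_0_INR; lia. }
  rewrite PSeries_0, Rminus_0_r, ln_1 in H; unfold log_coeff at 1 in H.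
  simpl in H; rewrite Rinv_0 in H; lra.
Qed.

(** With [L = - ln (1 - y)], the exponent is [P = L / y - L]; division by [y] is the index shift.
    The constant term is 1. *)
Definition exponent_coeff : nat -> R := PS_minus (PS_decr_1 log_coeff) log_coeff.

Lemma exponent_coeff_eq (n : nat) : exponent_coeff n = log_coeff (S n) - log_coeff n.
Proof. reflexivity. Qed.

Lemma exponent_coeff_bounded (n : nat) : Rabs (exponent_coeff n) <= 2.
Proof.
  assert (H1 := log_coeff_bounded (S n)); assert (H2 := log_coeff_bounded n).
  rewrite exponent_coeff_eq; unfold Rminus.
  eapply Rle_trans; [apply Rabs_triang|]; rewrite Rabs_Ropp; lra.
Qed.

Lemma PSeries_exponent_coeff (y : R) :
  0 < y < 1 -> PSeries exponent_coeff y = - (1 - y) * ln (1 - y) / y.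
Proof.
  intros Hy.
  assert (Hy1 : Rabs y < 1) by (rewrite Rabs_pos_eq; lra).
  assert (Hl := PSeries_log_coeff y Hy).
  assert (Hd : PSeries log_coeff y = y * PSeries (PS_decr_1 log_coeff) y).
  { apply PSeries_decr_1_aux; apply Rinv_0. }
  unfold exponent_coeff; rewrite PSeries_minus.
  - replace (PSeries (PS_decr_1 log_coeff) y) with (PSeries log_coeff y / y)
      by (rewrite Hd; field; lra).
    rewrite Hl; field; lra.
  - apply ex_pseries_of_bounded with 1; [intros n; apply log_coeff_bounded | exact Hy1].
  - apply ex_pseries_of_bounded with 1; [apply log_coeff_bounded | exact Hy1].
Qed.

(** This is the origin of the denominators [k + 2] in the recursion for [b]. *)
Lemma PS_derive_exponent_coeff (n : nat) :
  PS_derive exponent_coeff n = - / (INR n + 2).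
Proof.
  assert (H := pos_INR n).
  unfold PS_derive; rewrite exponent_coeff_eq; unfold log_coeff.
  rewrite !S_INR; field; lra.
Qed.

(** * The recursion for [b] as the differential equation [A' = A P'] *)

(** The last term stands apart because in the Cauchy product it is the one that meets the constant
    coefficient of [A], whose sign differs from that of the others. *)
Lemma fold_right_Rplus_seq (f : nat -> R) (n : nat) :
  fold_right Rplus 0 (map f (seq 0 n)) + f n = sum_f_R0 f n.
Proof.
  assert (Hr : forall l x, fold_right Rplus x l = fold_right Rplus 0 l + x).
  { induction l as [|h l IH]; intros x; simpl; [ring | rewrite IH; ring]. }
  induction n as [|n IH]; [simpl; ring|].
  rewrite seq_S, map_app, fold_right_app; simpl.
  rewrite Hr, <- IH; simpl; ring.
Qed.

Definition expansion_coeff (b : nat -> R) (k : nat) : R :=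
  match k with O => 1 | S _ => - b k end.

(** This is the recursion for [b (n+1)] multiplied by [-(n+1)]: the Cauchy product term [k = n]
    contains the constant coefficient 1 and yields [- 1 / (n + 2)], the summand standing outside the
    sum. *)
Lemma expansion_coeff_rec (b : nat -> R)
  (hb : forall n : nat, (1 <= n)%nat ->
     b n = 1 / INR n *
           (- fold_right Rplus 0
                (map (fun k : nat => b (n - 1 - k)%nat / (INR k + 2)) (seq 0 (n - 1)))
            + 1 / (INR n + 1))) (n : nat) :
  PS_derive (expansion_coeff b) n =
  PS_mult (PS_derive exponent_coeff) (expansion_coeff b) n.
Proof.
  assert (H := pos_INR n).
  unfold PS_mult; rewrite <- fold_right_Rplus_seq, Nat.sub_diag.
  unfold PS_derive at 1; simpl expansion_coeff; rewrite hb by lia.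
  replace (S n - 1)%nat with n by lia.
  rewrite PS_derive_exponent_coeff.
  replace (map (fun k => PS_derive exponent_coeff k * expansion_coeff b (n - k)) (seq 0 n))
    with (map (fun k => b (n - k)%nat / (INR k + 2)) (seq 0 n)).
  - rewrite S_INR; field; lra.
  - apply map_ext_in; intros k Hk; apply in_seq in Hk.
    rewrite PS_derive_exponent_coeff.
    assert (Hk' := pos_INR k).
    destruct (n - k)%nat eqn:E; [lia|]; simpl expansion_coeff; field; lra.
Qed.

(** By strong induction, [(n+1) * a (n+1)] is a sum of [n+1] products, each of absolute value at
    most 1 because the coefficients of [P'] are [- 1 / (k + 2)]. *)
Lemma expansion_coeff_bounded (a : nat -> R)
  (ha0 : a 0%nat = 1)
  (ha : forall n, PS_derive a n = PS_mult (PS_derive exponent_coeff) a n) (n : nat) :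
  Rabs (a n) <= 1.
Proof.
  induction n as [[|n] IH] using (well_founded_induction Nat.lt_wf_0).
  - rewrite ha0, Rabs_R1; lra.
  - assert (Hn : 0 < INR (S n)) by (apply lt_0_INR; lia).
    apply Rmult_le_reg_l with (INR (S n)); [exact Hn|].
    rewrite <- (Rabs_pos_eq (INR (S n))) at 1 by lra.
    rewrite <- Rabs_mult.
    change (INR (S n) * a (S n)) with (PS_derive a n).
    rewrite ha; unfold PS_mult.
    eapply Rle_trans; [apply Rsum_abs|].
    eapply Rle_trans; [apply (sum_Rle _ (fun _ => 1))|].
    + intros k Hk; rewrite Rabs_mult, PS_derive_exponent_coeff, Rabs_Ropp.
      assert (Hk' := pos_INR k).
      rewrite <- (Rmult_1_r 1); apply Rmult_le_compat; try apply Rabs_pos.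
      * rewrite Rabs_pos_eq by (left; apply Rinv_0_lt_compat; lra).
        rewrite <- Rinv_1; apply Rinv_le_contravar; lra.
      * apply IH; lia.
    + rewrite sum_cte; lra.
Qed.

(** The equation [A' = A P'] makes [A * exp (- P)] constant, so it keeps its value at 0. *)
Lemma PSeries_expansion_coeff (a : nat -> R)
  (ha0 : a 0%nat = 1)
  (ha : forall n, PS_derive a n = PS_mult (PS_derive exponent_coeff) a n) (y : R) :
  0 < y < 1 -> exp (PSeries exponent_coeff y) = exp 1 * PSeries a y.
Proof.
  intros Hy.
  set (f := fun t => PSeries a t * exp (- PSeries exponent_coeff t)).
  assert (H : f 0 = f y).
  { apply (eq_is_derive (V := R_NormedModule)); [|lra].
    intros t Ht.
    assert (Ht1 : Rabs t < 1) by (rewrite Rabs_pos_eq; lra).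
    assert (RA := lt_CV_radius_of_bounded _ _ _ (expansion_coeff_bounded a ha0 ha) Ht1).
    assert (RP := lt_CV_radius_of_bounded _ _ _ exponent_coeff_bounded Ht1).
    assert (DA := is_derive_PSeries _ _ RA).
    assert (DP := is_derive_PSeries _ _ RP).
    assert (E : PSeries (PS_derive a) t =
      PSeries (PS_derive exponent_coeff) t * PSeries a t).
    { rewrite (PSeries_ext _ _ _ ha).
      apply PSeries_mult; [now rewrite CV_radius_derive | exact RA]. }
    rewrite E in DA.
    unfold f; evar_last.
    - apply (is_derive_mult (K := R_AbsRing)); [exact DA | | apply Rmult_comm].
      apply (is_derive_comp exp); [apply is_derive_exp |].
      apply (is_derive_opp (V := R_NormedModule)); exact DP.
    - unfold zero, plus, mult, scal, opp; simpl; unfold mult; simpl; ring. }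
  (* Here [P 0 = / 1 - / 0 = 1], by the default value of [/ 0]; this is where the factor [exp 1]
     arises. *)
  unfold f in H; rewrite !PSeries_0, ha0, exponent_coeff_eq in H; unfold log_coeff in H.
  simpl INR in H; rewrite Rinv_0, Rinv_1, Rminus_0_r, !exp_Ropp in H.
  assert (H1 := exp_pos 1); assert (H2 := exp_pos (PSeries exponent_coeff y)).
  apply Rmult_eq_reg_r with (/ exp 1 * / exp (PSeries exponent_coeff y)).
  - transitivity (1 * / exp 1); [field; lra | rewrite H; field; lra].
  - apply Rgt_not_eq, Rmult_lt_0_compat; now apply Rinv_0_lt_compat.
Qed.

(** For [y = 1 / (m + 1)] one has [1 - y = 1 / (1 + 1/m)] and [(1 - y) / y = m], so
    [P y = m * ln (1 + 1/m)]. *)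
Lemma pow_eq_PSeries_expansion_coeff (a : nat -> R)
  (ha0 : a 0%nat = 1)
  (ha : forall n, PS_derive a n = PS_mult (PS_derive exponent_coeff) a n) (m : nat) :
  (1 <= m)%nat ->
  (1 + 1 / INR m) ^ m = exp 1 * PSeries a (/ (INR m + 1)).
Proof.
  intros Hm; assert (H : 1 <= INR m) by (apply (le_INR 1); exact Hm).
  assert (Hy : 0 < / (INR m + 1) < 1).
  { split; [apply Rinv_0_lt_compat; lra|].
    rewrite <- Rinv_1; apply Rinv_lt_contravar; lra. }
  rewrite <- (PSeries_expansion_coeff a ha0 ha), PSeries_exponent_coeff by exact Hy.
  assert (Hq : 0 < 1 + 1 / INR m).
  { assert (0 < 1 / INR m) by (apply Rdiv_lt_0_compat; lra); lra. }
  replace (1 - / (INR m + 1)) with (/ (1 + 1 / INR m)) by (field; lra).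
  rewrite ln_Rinv, <- Rpower_pow by exact Hq; unfold Rpower; f_equal; field; lra.
Qed.

(** * Re-expansion of powers of [y] in powers of [w] *)

(* [shift_coeff k s] is the coefficient of [w^s] in [(w / (1 + w/12))^k]. *)
Definition shift_coeff (k s : nat) : R :=
  match k, s with
  | O, O => 1
  | S k', S s' =>
      if (k' <=? s')%nat then (- / 12) ^ (s' - k') * Binomial.C s' k' else 0
  | _, _ => 0
  end.

Lemma C_n_0 (n : nat) : Binomial.C n 0 = 1.
Proof.
  unfold Binomial.C; rewrite Nat.sub_0_r; change (INR (fact 0)) with 1.
  field; apply INR_fact_neq_0.
Qed.

Lemma C_n_n (n : nat) : Binomial.C n n = 1.
Proof. rewrite pascal_step1, Nat.sub_diag by lia; apply C_n_0. Qed.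

(** Coefficient form of [(1 + w/12) * y ^ (k+1) = w * y ^ k] for [y = w / (1 + w/12)]. For the
    closed formula it is Pascal's rule, with separate cases on and above the diagonal. *)
Lemma shift_coeff_rec (k s : nat) :
  shift_coeff (S k) (S s) = shift_coeff k s - / 12 * shift_coeff (S k) s.
Proof.
  destruct k as [|k], s as [|s].
  - simpl; rewrite C_n_0; ring.
  - unfold shift_coeff; rewrite !leb_correct, !C_n_0, !Nat.sub_0_r by lia.
    simpl pow; ring.
  - simpl; ring.
  - unfold shift_coeff.
    destruct (lt_eq_lt_dec k s) as [[H|H]|H].
    + rewrite !leb_correct by lia.
      rewrite <- pascal by lia.
      replace (S s - S k)%nat with (S (s - S k)) by lia.
      replace (s - k)%nat with (S (s - S k)) by lia.
      simpl; ring.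
    + subst k; rewrite !leb_correct, leb_correct_conv, !Nat.sub_diag, !C_n_n by lia.
      simpl pow; ring.
    + rewrite !leb_correct_conv by lia; ring.
Qed.

(** The recursion closes since [2 ^ k + 2 ^ (k+1) / 12 <= 2 ^ (k+1)]. What matters is that the bound
    does not depend on [s], which gives convergence for [|w| < 1]. *)
Lemma shift_coeff_bounded (k s : nat) : Rabs (shift_coeff k s) <= 2 ^ k.
Proof.
  revert s; induction k as [|k IHk].
  - intros [|s]; simpl; rewrite ?Rabs_R1, ?Rabs_R0; lra.
  - assert (Hp : 0 < 2 ^ k) by (apply pow_lt; lra).
    induction s as [|s IHs]; [simpl; rewrite Rabs_R0; lra|].
    rewrite shift_coeff_rec; eapply Rle_trans; [apply Rabs_triang|].
    rewrite Rabs_Ropp, Rabs_mult, (Rabs_pos_eq (/ 12)) by lra.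
    specialize (IHk s); simpl pow in *; lra.
Qed.

Lemma PSeries_shift_coeff (k : nat) (w : R) :
  Rabs w < 1 -> PSeries (shift_coeff k) w = (w / (1 + w / 12)) ^ k.
Proof.
  intros Hw; assert (Hw' := Rabs_def2 _ _ Hw).
  assert (E : forall j, ex_pseries (shift_coeff j) w).
  { intros j; apply ex_pseries_of_bounded with (2 ^ j); [apply shift_coeff_bounded | exact Hw]. }
  induction k as [|k IH].
  - rewrite PSeries_decr_1 by apply E.
    rewrite (PSeries_ext _ (fun _ => 0)) by easy.
    rewrite PSeries_const_0; simpl; ring.
  (* The recursion summed over [s] is a linear equation for the unknown series, solvable because
     [1 + w/12] is nonzero. *)
  - assert (H : PSeries (shift_coeff (S k)) w =
        w * (PSeries (shift_coeff k) w - / 12 * PSeries (shift_coeff (S k)) w)).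
    { rewrite PSeries_decr_1_aux at 1 by easy; f_equal.
      rewrite <- PSeries_scal, <- PSeries_minus; [| apply E |].
      - apply PSeries_ext; intros s; unfold PS_decr_1; rewrite shift_coeff_rec.
        reflexivity.
      - apply ex_pseries_scal; [apply Rmult_comm | apply E]. }
    rewrite IH in H; simpl pow.
    set (p := (w / (1 + w / 12)) ^ k) in *.
    apply Rmult_eq_reg_l with (1 + w / 12); [|lra].
    transitivity (w * p); [|field; lra].
    lra.
Qed.

(** Truncation at [N] makes the rearrangement a finite sum of series and so avoids interchanging two
    infinite sums. *)
Lemma PSeries_sum_shift_coeff (a : nat -> R) (N : nat) (w : R) :
  Rabs w < 1 ->
  ex_pseries (fun s => sum_f_R0 (fun k => a k * shift_coeff k s) N) w /\
  PSeries (fun s => sum_f_R0 (fun k => a k * shift_coeff k s) N) w =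
  sum_f_R0 (fun k => a k * (w / (1 + w / 12)) ^ k) N.
Proof.
  intros Hw.
  assert (E : forall k, ex_pseries (PS_scal (a k) (shift_coeff k)) w).
  { intros k; apply ex_pseries_scal; [apply Rmult_comm|].
    apply ex_pseries_of_bounded with (2 ^ k); [apply shift_coeff_bounded | exact Hw]. }
  induction N as [|N [IH1 IH2]].
  - split; [exact (E 0%nat)|].
    change (PSeries (PS_scal (a 0%nat) (shift_coeff 0)) w = a 0%nat * (w / (1 + w / 12)) ^ 0).
    rewrite PSeries_scal, PSeries_shift_coeff by exact Hw; reflexivity.
  - split; [exact (ex_pseries_plus _ _ _ IH1 (E (S N)))|].
    rewrite tech5.
    rewrite <- IH2, <- (PSeries_shift_coeff (S N)), <- PSeries_scal by exact Hw.
    exact (PSeries_plus _ _ _ IH1 (E (S N))).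
Qed.

Lemma ex_derive_continuity_pt (f : R -> R) (x : R) : ex_derive f x -> continuity_pt f x.
Proof.
  intros H; apply continuity_pt_filterlim.
  now apply (ex_derive_continuous (V := R_NormedModule)).
Qed.

(** * Comparison of coefficients *)

Lemma coeff_eq_of_PSeries_eq (a c w : nat -> R) (M : R) :
  (forall n, Rabs (a n) <= M) -> is_lim_seq w 0 -> (forall m, 0 < w m < 1) ->
  (forall m, ex_pseries c (w m)) ->
  (forall m, PSeries c (w m) = PSeries a (w m / (1 + w m / 12))) ->
  forall s, c s = sum_f_R0 (fun k => a k * shift_coeff k s) s.
Proof.
  intros Ha Hw Hw1 Hc H s.
  (* Truncation order and target index are both [s]: the powers [y ^ k] with [k > s] contribute only
     from [w ^ (s+1)] on. *)
  set (U := fun s' => sum_f_R0 (fun k => a k * shift_coeff k s') s).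
  assert (Hw2 : forall m, Rabs (w m) < 1).
  { intros m; specialize (Hw1 m); rewrite Rabs_pos_eq; lra. }
  assert (EU : forall m, ex_pseries U (w m)).
  { intros m; apply (PSeries_sum_shift_coeff a s (w m) (Hw2 m)). }
  assert (Z : PS_minus c U s = 0).
  { apply (PSeries_coeff_eq_0 (PS_minus c U) w
      (fun x => (/ (1 + x / 12)) ^ S s * PSeries (PS_decr_n a (S s)) (x / (1 + x / 12))) s);
      [| exact Hw | | | | lia].
    - apply CV_radius_pos_of_ex_pseries with (w 0%nat);
        [specialize (Hw1 0%nat); lra | now apply ex_pseries_minus].
    - intros m; specialize (Hw1 m); lra.
    - apply continuity_pt_mult.
      + apply ex_derive_continuity_pt.
        auto_derive; lra.
      + apply continuity_pt_comp with (f1 := fun x => x / (1 + x / 12)).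
        * apply ex_derive_continuity_pt.
          auto_derive; lra.
        * apply PSeries_continuity, lt_CV_radius_of_bounded with M; [intros n; apply Ha|].
          unfold Rdiv; rewrite Rmult_0_l, Rabs_R0; lra.
    - intros m; specialize (Hw1 m).
      rewrite PSeries_minus, H by auto.
      unfold U; rewrite (proj2 (PSeries_sum_shift_coeff a s (w m) (Hw2 m))).
      rewrite (PSeries_decr_n a s).
      + set (y := w m / (1 + w m / 12)).
        replace (y ^ S s) with (w m ^ S s * (/ (1 + w m / 12)) ^ S s)
          by (symmetry; apply Rpow_mult_distr).
        ring.
      + apply ex_pseries_of_bounded with M; [exact Ha|].
        assert (0 < w m / (1 + w m / 12)) by (apply Rdiv_lt_0_compat; lra).
        rewrite Rabs_pos_eq by lra.
        apply Rmult_lt_reg_r with (1 + w m / 12); [lra|].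
        replace (w m / (1 + w m / 12) * (1 + w m / 12)) with (w m) by (field; lra); lra. }
  unfold PS_minus, PS_plus, PS_opp, plus, opp in Z.
  simpl in Z; fold (U s); lra.
Qed.

(** The binomial coefficient [C (s-1) (k-1)] is [Gamma s / (Gamma (s-k+1) * Gamma k)], all arguments
    being positive integers. *)
Lemma shift_coeff_Gamma (k s : nat) :
  (1 <= k <= s)%nat ->
  shift_coeff k s =
  Gamma (INR s) * ((-1) ^ (s - k) *
    / (Gamma (INR s - INR k + 1) * Gamma (INR k) * 12 ^ (s - k))).
Proof.
  destruct k as [|k], s as [|s]; try lia; intros H.
  rewrite <- minus_INR, Gamma_fact, !S_INR, !Gamma_fact by lia.
  unfold shift_coeff; rewrite leb_correct by lia; simpl Nat.sub.
  replace (- / 12) with (-1 * / 12) by lra.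
  rewrite Rpow_mult_distr, pow_inv; unfold Binomial.C.
  field; repeat split; try apply not_0_INR, fact_neq_0; apply pow_nonzero; lra.
Qed.

(** * Application to the given expansion *)

Theorem theorem1 (b d : nat -> R)
  (hb0 : b 0%nat = 1)
  (hb : forall n : nat, (1 <= n)%nat ->
     b n = 1 / INR n *
           (- fold_right Rplus 0
                (map (fun k : nat => b (n - 1 - k)%nat / (INR k + 2)) (seq 0 (n - 1)))
            + 1 / (INR n + 1)))
  (hd : forall m : nat, (1 <= m)%nat ->
     ex_series (fun s : nat => d (S s) / (INR m + 11 / 12) ^ (S s)) /\
     (1 + 1 / INR m) ^ m =
     exp 1 * (d 0%nat - Series (fun s : nat => d (S s) / (INR m + 11 / 12) ^ (S s)))) :
  d 0%nat = 1 /\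
  forall s : nat, (1 <= s)%nat ->
    d s = Gamma (INR s) *
          sum_n_m (fun k : nat =>
            (-1) ^ (s - k) *
            (b k / (Gamma (INR s - INR k + 1) * Gamma (INR k) * 12 ^ (s - k)))) 1 s.
Proof.
  (* Absorbing the minus sign turns the bracket in [hd] into the plain power series of [c] at [w].
     The sequence [w] starts at [S m], since [hd] begins at 1. *)
  set (c := fun s => match s with O => d 0%nat | S _ => - d s end).
  set (w := fun m => / (INR (S m) + 11 / 12)).
  assert (Hm : forall m, 1 <= INR (S m)).
  { intros m; apply (le_INR 1); lia. }
  assert (Hw : forall m, 0 < w m < 1).
  { intros m; specialize (Hm m); unfold w; split; [apply Rinv_0_lt_compat; lra|].
    rewrite <- Rinv_1; apply Rinv_lt_contravar; lra. }
  assert (Hterm : forall m s,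
    c (S s) * w m ^ S s = - (d (S s) / (INR (S m) + 11 / 12) ^ S s)).
  { intros m s; unfold w; rewrite pow_inv; unfold c, Rdiv; ring. }
  assert (Hex : forall m, ex_pseries c (w m)).
  { intros m; apply ex_pseries_R, ex_series_incr_1.
    eapply ex_series_ext; [intros s; symmetry; apply Hterm|].
    apply (ex_series_opp (V := R_NormedModule)); apply hd; lia. }
  assert (Hc : forall s, c s = sum_f_R0 (fun k => expansion_coeff b k * shift_coeff k s) s).
  { apply coeff_eq_of_PSeries_eq with w 1;
      [now apply expansion_coeff_bounded, expansion_coeff_rec | | exact Hw | exact Hex |].
    - unfold w; replace (Finite 0) with (Rbar_inv p_infty) by reflexivity.
      apply is_lim_seq_inv; [|discriminate].
      apply is_lim_seq_le_p_loc with INR; [|apply is_lim_seq_INR].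
      exists 0%nat; intros n _; rewrite S_INR; lra.
    - intros m; specialize (Hm m).
      (* With [n = S m], [1/w + 1/12 = n + 11/12 + 1/12 = n + 1]: the shift [11/12] of the theorem
         matches the [1/12] of [shift_coeff]. *)
      replace (w m / (1 + w m / 12)) with (/ (INR (S m) + 1)) by (unfold w; field; lra).
      assert (He := exp_pos 1).
      apply Rmult_eq_reg_l with (exp 1); [|lra].
      rewrite <- (pow_eq_PSeries_expansion_coeff _ eq_refl (expansion_coeff_rec b hb)) by lia.
      rewrite (proj2 (hd (S m) ltac:(lia))); f_equal.
      unfold PSeries; rewrite Series_incr_1 by now apply ex_pseries_R.
      rewrite (Series_ext _ _ (Hterm m)), Series_opp.
      unfold c; simpl pow; ring. }
  split.
  - change (d 0%nat) with (c 0%nat); rewrite Hc; simpl; ring.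
  - intros [|s] Hs; [lia|].
    replace (d (S s)) with (- c (S s)) by (unfold c; ring).
    rewrite Hc, <- sum_n_Reals; unfold sum_n.
    (* The term [k = 0] is split off; it vanishes because [y ^ 0 = 1] has no positive power of [w],
       so the sum starts at 1. *)
    rewrite sum_Sn_m by lia.
    change (expansion_coeff b 0 * shift_coeff 0 (S s)) with (1 * 0).
    rewrite <- (sum_n_m_mult_l (K := R_Ring)).
    unfold plus; simpl AbelianMonoid.plus; rewrite Rmult_0_r, Rplus_0_l.
    replace (- sum_n_m (fun k => expansion_coeff b k * shift_coeff k (S s)) 1 (S s))
      with (-1 * sum_n_m (fun k => expansion_coeff b k * shift_coeff k (S s)) 1 (S s)) by ring.
    rewrite <- (sum_n_m_mult_l (K := R_Ring)).
    apply sum_n_m_ext_loc; intros k Hk.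
    rewrite shift_coeff_Gamma by exact Hk.
    destruct k as [|k]; [lia|].
    change (expansion_coeff b (S k)) with (- b (S k)).
    match goal with |- ?x = ?y => change (@eq R x y) end.
    repeat change (mult ?x ?y) with (Rmult x y); unfold Rdiv; ring.
Qed.
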